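(* Let $r$ be a positive integer and let $D$ be a finite digraph with no $(r-1)$-source sets. Then $D$ contains $r$ pairwise disjoint $2^{r+1}$-kernels.
   Context: For a set $S$ of vertices, $N^-(S)=\{u\in V(D)\setminus S:\ \exists v\in S,\ uv\in E(D)\}$. A set $S\subseteq V(D)$ is a source set if $N^-(S)=\emptyset$; it is an $s$-source set if moreover $S$ is non-empty and $|S|\le s$. A set of vertices is independent if there are no arcs between two of its vertices. $\mathrm{dist}(u,v)$ is the length of a shortest directed path from $u$ to $v$, and $\mathrm{dist}(S,v)=\min_{u\in S}\mathrm{dist}(u,v)$. For an integer $q\ge 1$, a $q$-kernel is an independent set $Q$ with $\mathrm{dist}(Q,v)\le q$ for all $v\in V(D)$. *)

(* Defs.v *)
From mathcomp Require Import all_boot.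
Set Implicit Arguments.
Unset Strict Implicit.
Unset Printing Implicit Defensive.

(* A finite digraph is a finType V of vertices with its arc relation e : rel V;
   e u v means that uv is an arc. Opposite arcs uv, vu are allowed. *)
Section Digraph.
Variables (V : finType) (e : rel V).

Definition in_nbrs (S : {set V}) : {set V} :=
  [set u | (u \notin S) && [exists v in S, e u v]].

Definition source_set (S : {set V}) : bool := in_nbrs S == set0.

Definition s_source_set (s : nat) (S : {set V}) : bool :=
  [&& source_set S, S != set0 & #|S| <= s].

(* "Two vertices" are distinct vertices: a loop, if e has any, does not destroy
   independence, so loops are irrelevant to all the notions defined here. *)
Definition independent (S : {set V}) : bool :=
  [forall u in S, forall v in S, (u != v) ==> ~~ e u v].

(* u :: p is a directed path (no repeated vertex) from u to v, of length size p *)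
Definition dipath (u v : V) (p : seq V) : bool :=
  [&& path e u p, last u p == v & uniq (u :: p)].

Definition dipath_len (u v : V) (n : nat) : bool :=
  [exists p : n.-tuple V, dipath u v p].

(* Distances lie in option nat, with None for infinity (no directed path).
   A directed path has length less than #|V|, so iota 0 #|V| lists, in
   increasing order, all the candidate lengths. *)
Definition dist (u v : V) : option nat :=
  ohead [seq n <- iota 0 #|V| | dipath_len u v n].

(* oAC extends minn to option nat with None as neutral element. *)
Definition dist_set (S : {set V}) (v : V) : option nat :=
  \big[oAC minnA minnC/None]_(u in S) dist u v.

Definition dist_le (d : option nat) (q : nat) : bool :=
  if d is Some n then n <= q else false.

Definition q_kernel (q : nat) (Q : {set V}) : bool :=
  independent Q && [forall v, dist_le (dist_set Q v) q].

End Digraph.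

(* Main.v *)
Require Import Defs.
From mathcomp Require Import all_boot.
From mathcomp Require Import zify.

(** An independent set comes for free: a set [X] of vertices contains a
    2-kernel [Q] of the digraph induced on [X] (Chvatal-Lovasz), so if [X]
    reaches every vertex within [q] steps, then [Q] does so within [q + 2]
    steps.  It thus suffices to colour the vertices with [r] colours in such a
    way that every vertex is reached from every colour within [4r - 4] steps.

    Let [R] be an inclusion-minimal set from which all vertices are reachable,
    [d v] the distance from [R] to [v], and [B x] the set of vertices at distance
    less than [r] to [x].  As there is no small source set, [B x] has at least
    [r] elements.  Colour [v] with [d v %% r], except that [B x] is recoloured
    with all the colours whenever [x] is a root (an element of [R]) such that
    [d < r - 1] on [B x].  A vertex with [d v >= 2r - 2] sees all the colours on
    the last [r] vertices of a shortest path from [R].  Any other vertex is close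
    to a root [x]; either [B x] has all the colours, or some [y] in [B x] has
    [d y >= r - 1], and then a shortest path from [R] to [y] has all of them. *)

Set Implicit Arguments.
Unset Strict Implicit.
Unset Printing Implicit Defensive.

(** * Bounded reachability and 2-kernels *)

Section Reach.
Variables (V : finType) (e : rel V).

(** Walks with at most [n] arcs: the choice [w == v] lets a step stay put. Vertices may repeat, so
    walks concatenate freely. *)
Fixpoint reach (n : nat) (u v : V) : bool :=
  if n is m.+1 then [exists w, reach m u w && ((w == v) || e w v)] else u == v.

Lemma reach_refl n u : reach n u u.
Proof.
elim: n => [|n IHn] /=; first exact: eqxx.
by apply/existsP; exists u; rewrite IHn eqxx.
Qed.

Lemma reach_trans m n u v w : reach m u v -> reach n v w -> reach (m + n) u w.
Proof.
move=> ruv; elim: n w => [|n IHn] w /=; first by rewrite addn0 => /eqP <-.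
case/existsP=> t /andP[rvt tw]; rewrite addnS /=; apply/existsP; exists t.
by rewrite IHn.
Qed.

Lemma reach_leq m n u v : m <= n -> reach m u v -> reach n u v.
Proof. by move=> /subnKC <- ruv; apply: reach_trans ruv (reach_refl _ _). Qed.

Lemma reach_arc u v : e u v -> reach 1 u v.
Proof. by move=> uv; apply/existsP; exists u; rewrite uv orbT /= eqxx. Qed.

Lemma reach_path n u v :
  reach n u v -> exists p, [/\ path e u p, last u p = v & size p <= n].
Proof.
elim: n v => [|n IHn] v /=; first by move/eqP => <-; exists [::].
case/existsP=> w /andP[/IHn[p [ep lp sp]] /orP[/eqP <-|wv]].
  by exists p; split=> //; apply: leqW.
by exists (rcons p v); rewrite rcons_path ep lp last_rcons size_rcons.
Qed.

Lemma path_reach u p : path e u p -> reach (size p) u (last u p).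
Proof.
elim: p u => [|v p IHp] u /=; first by move=> _; apply: eqxx.
by case/andP=> /reach_arc uv /IHp; apply: (reach_trans uv).
Qed.

Lemma reach_connect n u v : reach n u v -> connect e u v.
Proof. by case/reach_path=> p [ep <- _]; apply/connectP; exists p. Qed.

Lemma connect_reach u v : connect e u v -> exists n, reach n u v.
Proof. by case/connectP=> p ep ->; exists (size p); apply: path_reach. Qed.

(** Shortening the walk gives a directed path, whose length is in the filtered list; that list is
    sorted, so its head is no larger. *)
Lemma reach_dist n u v : reach n u v -> dist_le (dist e u v) n.
Proof.
case/reach_path=> p0 [/shortenP[p ep up /(uniq_leq_size) sp] lp sn].
have szp : size p <= n by apply: leq_trans sn; apply: sp; case/andP: up.
have in_p : size p \in [seq n <- iota 0 #|V| | dipath_len e u v n].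
  rewrite mem_filter mem_iota /= add0n.
  have -> : size p < #|V| by rewrite -[_.+1]/(size (u :: p)) -(card_uniqP up) max_card.
  by rewrite andbT; apply/existsP; exists (in_tuple p); rewrite /dipath ep lp eqxx.
have : sorted leq [seq n <- iota 0 #|V| | dipath_len e u v n].
  by apply: (sorted_filter leq_trans); apply: iota_sorted.
rewrite /dist; move: in_p; case: [seq _ <- _ | _] => //= m s.
rewrite inE => /orP[/eqP <- //|ps] /(order_path_min leq_trans)/allP/(_ _ ps) le_m.
exact: leq_trans szp.
Qed.

Lemma dist_le_set (Q : {set V}) u v n :
  u \in Q -> dist_le (dist e u v) n -> dist_le (dist_set e Q v) n.
Proof.
move=> uQ; rewrite /dist_set (bigD1 u) //=.
case: (dist e u v) => //= k le_kn.
by case: (\big[_/_]_(_ | _) _) => //= m; rewrite geq_min le_kn.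
Qed.

(** Induction on [#|A|]: delete a vertex [v] and its out-neighbours, and take [Q] for the rest. If
    [Q] has an arc to [v], it reaches the deleted vertices in two steps; otherwise [v] can be added
    to [Q]. *)
Lemma two_kernel_sub (A : {set V}) :
  exists Q : {set V}, [/\ Q \subset A, independent e Q &
    forall v, v \in A -> exists2 u, u \in Q & reach 2 u v].
Proof.
have [n] := ubnP #|A|; elim: n A => // n IHn A; rewrite ltnS => leAn.
have [-> | [v vA]] := set_0Vmem A.
  exists set0; split; [exact: sub0set | | by move=> v; rewrite inE].
  by apply/forall_inP=> u; rewrite inE.
pose A' := [set u in A | (u != v) && ~~ e v u].
have A'A : A' \subset A by apply/subsetP=> u; rewrite inE => /andP[].
have [|Q [QA' /forall_inP indQ domQ]] := IHn A'.
  apply: leq_trans leAn; apply: proper_card; rewrite properE A'A /=.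
  by apply/subsetPn; exists v; rewrite // inE eqxx andbF.
have domA u : u \in A -> u \notin A' -> reach 1 v u.
  move=> uA; rewrite inE uA andTb negb_and !negbK => /orP[/eqP->|/reach_arc //].
  exact: reach_refl.
have [/exists_inP[q qQ qv] | /exists_inPn noQv] := boolP [exists q in Q, e q v].
  exists Q; split; [exact: subset_trans A'A | exact/forall_inP |] => u uA.
  have [/domQ // | /(domA _ uA) vu] := boolP (u \in A').
  by exists q => //; apply: reach_trans (reach_arc qv) vu.
exists (v |: Q); split.
- by rewrite subUset sub1set vA (subset_trans QA' A'A).
- apply/forall_inP=> u; rewrite in_setU1 => uQ; apply/forall_inP=> w.
  rewrite in_setU1; case/predU1P: uQ => [-> | uQ] /predU1P[-> | wQ].
  + by rewrite eqxx.
  + by apply/implyP=> _; move/(subsetP QA'): wQ; rewrite inE => /and3P[].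
  + by apply/implyP=> _; apply: noQv.
  + exact: (forall_inP (indQ _ uQ)).
- move=> u uA; have [/domQ[q qQ qu] | /(domA _ uA) vu] := boolP (u \in A').
    by exists q; rewrite // in_setU1 qQ orbT.
  by exists v; [rewrite setU11 | apply: reach_leq vu].
Qed.

Lemma q_kernel_sub q (X : {set V}) :
    (forall v, exists2 u, u \in X & reach q u v) ->
  exists2 Q : {set V}, Q \subset X & q_kernel e (q + 2) Q.
Proof.
move=> domX; have [Q [QX indQ domQ]] := two_kernel_sub X.
exists Q => //; apply/andP; split=> //; apply/forallP=> v.
have [u /domQ[w wQ wu] uv] := domX v.
by apply: dist_le_set wQ _; rewrite addnC; apply/reach_dist/(reach_trans wu).
Qed.

(** * Minimal root sets and in-balls *)

Lemma exists_minimal_roots : exists R : {set V},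
  (forall v, exists2 x, x \in R & connect e x v) /\
  {in R &, forall x y, connect e x y -> x = y}.
Proof.
pose P (R : {set V}) := [forall v, exists x in R, connect e x v].
have PT : P setT.
  by apply/forallP=> v; apply/exists_inP; exists v; rewrite ?inE ?connect0.
have [R /minsetP[/forallP PR minR]] : {R | minset P R} by apply: ex_minset; exists setT.
exists R; split=> [v | x y xR yR xy]; first exact/exists_inP.
apply/eqP/negPn/negP=> neq_xy.
have /minR : P (R :\ y).
  apply/forallP=> v; have /exists_inP[z zR zv] := PR v; apply/exists_inP.
  have [eq_zy | neq_zy] := eqVneq z y; last by exists z; rewrite // !inE neq_zy.
  by exists x; rewrite ?inE ?neq_xy // (connect_trans xy) // -eq_zy.
by rewrite subsetDl => /(_ isT)/setP/(_ y); rewrite !inE eqxx yR.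
Qed.

Definition in_ball (n : nat) (x : V) : {set V} := [set u | reach n u x].

(** A ball that is a source set has at least [r] vertices already; any other has an in-neighbour,
    which the next ball gains. *)
Lemma card_in_ball r n x :
    (forall S : {set V}, ~~ s_source_set e (r - 1) S) ->
  n < r -> n < #|in_ball n x|.
Proof.
move=> no_source; elim: n => [|n IHn] lt_nr.
  by apply/card_gt0P; exists x; rewrite inE reach_refl.
have sub : in_ball n x \subset in_ball n.+1 x.
  by apply/subsetP=> u; rewrite !inE; apply: reach_leq.
have [src | /set0Pn[u]] := eqVneq (in_nbrs e (in_ball n x)) set0.
  have := no_source (in_ball n x); rewrite /s_source_set /source_set src eqxx /=.
  have -> /= : in_ball n x != set0 by apply/set0Pn; exists x; rewrite inE reach_refl.
  rewrite -ltnNge => ?; apply: leq_trans (subset_leq_card sub); lia.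
rewrite inE => /andP[uB /exists_inP[v vB uv]].
apply: leq_ltn_trans (IHn (ltnW lt_nr)) _; apply: proper_card.
rewrite properE sub /=; apply/subsetPn; exists u => //.
by move: vB; rewrite !inE; apply: reach_trans (reach_arc uv).
Qed.

End Reach.

(** The [r] consecutive numbers ending at [m] show every residue; [r <= m.+1] keeps the subtraction
    from being truncated. *)
Lemma modn_window r m i : r <= m.+1 -> i < r -> exists2 j, j < r & (m - j) %% r = i.
Proof.
move=> le_rm lt_ir; have r_gt0 : 0 < r by apply: leq_trans lt_ir.
have lt_tr := ltn_pmod m r_gt0; have Em := divn_eq m r.
have [le_it | lt_ti] := leqP i (m %% r).
  exists (m %% r - i); first lia.
  have -> : m - (m %% r - i) = m %/ r * r + i by lia.
  by rewrite modnMDl modn_small.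
have q_gt0 : 0 < m %/ r by rewrite divn_gt0 //; case: (ltnP m r) => // /modn_small; lia.
exists (m %% r + r - i); first lia.
have -> : m - (m %% r + r - i) = (m %/ r).-1 * r + i.
  by rewrite -subn1 mulnBl mul1n; have := leq_pmull r q_gt0; lia.
by rewrite modnMDl modn_small.
Qed.

(** * Distance from the roots *)

Section Depth.
Variables (V : finType) (e : rel V) (R : {set V}).
Hypothesis R_spans : forall v, exists2 x, x \in R & connect e x v.

Lemma exists_reach_roots v : exists n, [exists x in R, reach e n x v].
Proof.
have [x xR /connect_reach[n xv]] := R_spans v.
by exists n; apply/exists_inP; exists x.
Qed.

Definition depth (v : V) : nat := ex_minn (exists_reach_roots v).

Lemma depth_reach v : exists2 x, x \in R & reach e (depth v) x v.
Proof. by rewrite /depth; case: ex_minnP => n /exists_inP. Qed.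

Lemma depth_leq n x v : x \in R -> reach e n x v -> depth v <= n.
Proof.
move=> xR xv; rewrite /depth; case: ex_minnP => m _; apply.
by apply/exists_inP; exists x.
Qed.

Lemma depth_pred v m : depth v = m.+1 -> exists2 w, e w v & depth w = m.
Proof.
move=> dv; have [x xR] := depth_reach v; rewrite dv /=.
case/existsP=> w /andP[xw /predU1P[eq_wv | wv]].
  by move: xw; rewrite eq_wv => /(depth_leq xR); rewrite dv ltnn.
exists w => //; apply/eqP; rewrite eqn_leq (depth_leq xR xw) /=.
have [y yR yw] := depth_reach w.
by have := depth_leq yR (reach_trans yw (reach_arc wv)); rewrite dv addn1.
Qed.

Lemma depth_ancestor j v :
  j <= depth v -> exists2 w, reach e j w v & depth w = depth v - j.
Proof.
elim: j => [|j IHj] lt_jv; first by exists v; rewrite ?subn0 // reach_refl.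
have [w wv dw] := IHj (ltnW lt_jv).
have [|t tw dt] := @depth_pred w (depth v - j.+1); first by lia.
by exists t => //; apply: reach_trans (reach_arc tw) wv.
Qed.

Lemma depth_residue r i v : r <= (depth v).+1 -> i < r ->
  exists w, [/\ reach e (r - 1) w v, depth w %% r = i & depth v <= depth w + (r - 1)].
Proof.
move=> le_rv /(modn_window le_rv)[j lt_jr <-].
have [|w wv dw] := @depth_ancestor j v; first by lia.
exists w; split; rewrite ?dw //; last by lia.
by apply: reach_leq wv; lia.
Qed.

End Depth.

(** * The colouring *)

Section Colouring.
Variables (V : finType) (e : rel V) (r : nat) (R : {set V}).
Hypothesis no_source : forall S : {set V}, ~~ s_source_set e (r - 1) S.
Hypothesis R_spans : forall v, exists2 x, x \in R & connect e x v.
Hypothesis R_min : {in R &, forall x y, connect e x y -> x = y}.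

Local Notation d := (depth R_spans).
Local Notation B := (in_ball e (r - 1)).

(** A root reaching [w] reaches both [x] and [y], hence equals both. Thus balls of distinct roots
    are disjoint, and the [pick] in [colour] is unambiguous. *)
Lemma root_unique w x y :
  x \in R -> y \in R -> connect e w x -> connect e w y -> x = y.
Proof.
move=> xR yR wx wy; have [z zR zw] := R_spans w.
rewrite -(R_min zR xR (connect_trans zw wx)).
exact: R_min (connect_trans zw wy).
Qed.

Definition shallow (x : V) : bool := [forall y in B x, d y < r - 1].

Definition colour (v : V) : nat :=
  if [pick x | [&& x \in R, shallow x & v \in B x]] is Some x
  then index v (enum (B x)) %% r else d v %% r.

Lemma colour_shallow x v : x \in R -> shallow x -> v \in B x ->
  colour v = index v (enum (B x)) %% r.
Proof.
move=> xR shx vB; rewrite /colour; case: pickP => [y /and3P[yR _] | /(_ x)].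
  move: (vB); rewrite !inE => /reach_connect vx /reach_connect vy.
  by rewrite (root_unique yR xR vy vx).
by rewrite xR shx vB.
Qed.

Lemma colour_depth v : (forall x, x \in R -> shallow x -> v \notin B x) ->
  colour v = d v %% r.
Proof.
move=> notB; rewrite /colour; case: pickP => // x /and3P[xR shx].
by rewrite (negPf (notB _ xR shx)).
Qed.

Lemma colour_near v i : i < r -> exists2 u, colour u = i & reach e (4 * r - 4) u v.
Proof.
move=> lt_ir; have [le_v | lt_v] := leqP (2 * r - 2) (d v).
  have [|w [wv dw le_vw]] := @depth_residue _ _ _ R_spans r i v _ lt_ir; first by lia.
  exists w; last by apply: reach_leq wv; lia.
  (* [d w >= r - 1] as [d v >= 2 * r - 2], so [w] is in no ball of a shallow root. *)
  rewrite colour_depth // => x xR /forall_inP shx; apply/negP=> /shx; lia.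
have [x xR xv] := depth_reach R_spans v.
have [shx | ] := boolP (shallow x).
  have lt_iB : i < #|B x|.
    by apply: leq_trans lt_ir _; have := @card_in_ball _ e r (r - 1) x no_source; lia.
  pose u := nth x (enum (B x)) i.
  have uB : u \in B x by rewrite -mem_enum mem_nth // -cardE.
  exists u.
    by rewrite (colour_shallow xR shx uB) index_uniq ?enum_uniq -?cardE // modn_small.
  move: uB; rewrite inE => ux; apply: reach_leq (reach_trans ux xv); lia.
case/forall_inPn=> y; rewrite inE -leqNgt => yx le_y.
have [|w [wy dw _]] := @depth_residue _ _ _ R_spans r i y _ lt_ir; first by lia.
have wx := reach_trans wy yx.
(* Two stretches of [r - 1] lead from [w] to [x], and at most [2 * r - 3] further steps to [v]. *)
exists w; last by apply: reach_leq (reach_trans wx xv); lia.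
rewrite colour_depth // => z zR /forall_inP shz; rewrite inE; apply/negP=> wz.
have eq_xz := root_unique xR zR (reach_connect wx) (reach_connect wz).
have /shz : y \in B z by rewrite -eq_xz inE.
lia.
Qed.

End Colouring.

Theorem theorem2p4 (V : finType) (e : rel V) (r : nat) (r_gt0 : 0 < r)
    (no_source : forall S : {set V}, ~~ s_source_set e (r - 1) S) :
  exists Q : 'I_r -> {set V},
    (forall i : 'I_r, q_kernel e (2 ^ (r + 1)) (Q i)) /\
    (forall i j : 'I_r, i != j -> [disjoint Q i & Q j]).
Proof.
have [R [R_spans R_min]] := exists_minimal_roots e.
pose X (i : 'I_r) := [set v | colour r R_spans v == i].
(* The 2 subtracted pays for passing from a colour class to its 2-kernel. *)
have le_q : 4 * r - 4 <= 2 ^ (r + 1) - 2.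
  case: r r_gt0 {no_source X} => // s _; rewrite addn1 !expnS.
  by have := ltn_expl s (isT : 1 < 2); lia.
have kerX i : exists2 Q : {set V}, Q \subset X i & q_kernel e (2 ^ (r + 1)) Q.
  have -> : 2 ^ (r + 1) = 2 ^ (r + 1) - 2 + 2.
    by rewrite addn1 expnS; have := expn_gt0 2 r; lia.
  apply: q_kernel_sub => v.
  have [u cu uv] := colour_near no_source R_spans R_min v (ltn_ord i).
  by exists u; [rewrite inE cu | apply: reach_leq uv].
have [Q QX kerQ] := fin_all_exists2 kerX.
exists Q; split=> // i j neq_ij; rewrite disjoint_subset; apply/subsetP=> v.
move/(subsetP (QX i)); rewrite !inE => /eqP cv; apply: contra neq_ij.
by move/(subsetP (QX j)); rewrite inE cv.
Qed.
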